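(* Let $t$ be a positive integer. There exists a polynomial $P_t$ such that $\chi(G)\le P_t(\mathbf{bp}_t(G))$ for every graph $G$ if and only if there exists a polynomial $P_1$ such that $\chi(G)\le P_1(\mathbf{bp}_1(G))$ for every graph $G$.
   Context: $\chi(G)$ is the chromatic number. For a positive integer $t$, a $t$-biclique covering of an undirected graph $G$ is a collection of complete bipartite subgraphs of $G$ such that every edge of $G$ is covered at least once and at most $t$ times; $\mathbf{bp}_t(G)$ is the minimum size of such a covering. In particular $\mathbf{bp}_1(G)$ is the minimum number of edge-disjoint complete bipartite subgraphs partitioning the edge set of $G$. *)

(* Defs.v *)
From mathcomp Require Import all_boot.

Set Implicit Arguments.
Unset Strict Implicit.
Unset Printing Implicit Defensive.

Record sgraph := SGraph {
  vertex :> finType;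
  adj : rel vertex;
  adj_sym : symmetric adj;
  adj_irrefl : irreflexive adj
}.

Section Graph.
Variable G : sgraph.

Definition colorable (k : nat) : bool :=
  [exists f : {ffun G -> 'I_k}, forall x, forall y, adj x y ==> (f x != f y)].

Lemma ex_colorable : exists k, colorable k.
Proof.
exists #|G|; apply/existsP; exists [ffun x => enum_rank x].
apply/'forall_forallP => x y; apply/implyP => xy; rewrite !ffunE.
apply: contraTneq xy => /enum_rank_inj ->; by rewrite adj_irrefl.
Qed.

Definition chi : nat := ex_minn ex_colorable.

Definition edges : {set {set G}} :=
  [set [set p.1; p.2] | p : G * G & adj p.1 p.2].

Definition cross_edges (A B : {set G}) : {set {set G}} :=
  [set [set p.1; p.2] | p in setX A B].

(* A complete bipartite subgraph (with both sides nonempty, not necessarily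
   induced) has no isolated vertex, so it is encoded by its edge set. *)
Definition is_biclique (H : {set {set G}}) : bool :=
  (H \subset edges) &&
  [exists A : {set G}, exists B : {set G},
    [&& A != set0, B != set0, [disjoint A & B] & H == cross_edges A B]].

Definition is_biclique_covering (t : nat) (C : {set {set {set G}}}) : bool :=
  [forall H in C, is_biclique H] &&
  [forall e in edges, 1 <= #|[set H in C | e \in H]| <= t].

Definition single_edges : {set {set {set G}}} := [set [set e] | e in edges].

(* [single_edges] is a covering exactly because 0 < t (see [bp_spec]); for
   t = 0 the value is not meaningful. *)
Definition bp (t : nat) : nat :=
  #|[arg min_(C < single_edges | is_biclique_covering t C) #|C|]|.

Lemma single_edges_covering t : 0 < t -> is_biclique_covering t single_edges.
Proof.
move=> t_gt0; apply/andP; split.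
  apply/forall_inP => _ /imsetP[e eE ->]; apply/andP; split.
    by rewrite sub1set.
  have /imsetP[[x y] /=] := eE; rewrite inE /= => xy ->.
  apply/existsP; exists [set x]; apply/existsP; exists [set y].
  apply/and4P; split.
  - by apply/set0Pn; exists x; rewrite inE.
  - by apply/set0Pn; exists y; rewrite inE.
  - rewrite disjoints1 inE; apply: contraTneq xy => ->; by rewrite adj_irrefl.
  apply/eqP/setP => a; rewrite inE; apply/eqP/imsetP => [->|[[u v]]].
    by exists (x, y); rewrite // !inE /= !eqxx.
  by rewrite !inE /= => /andP[/eqP-> /eqP->].
apply/forall_inP => e eE.
suff -> : [set H in single_edges | e \in H] = [set [set e]] by rewrite cards1.
apply/setP => H; rewrite !inE; apply/andP/eqP => [[/imsetP[f _ ->]]|->].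
  by rewrite inE => /eqP->.
by rewrite set11; split=> //; apply/imsetP; exists e.
Qed.

Lemma bp_spec t : 0 < t ->
  (exists2 C, is_biclique_covering t C & #|C| = bp t) /\
  (forall C, is_biclique_covering t C -> bp t <= #|C|).
Proof.
move=> t_gt0; rewrite /bp.
case: arg_minnP => [|C covC minC]; first exact: single_edges_covering.
by split; first exists C.
Qed.

End Graph.

(* Main.v *)
(* The nontrivial direction goes by induction on t. Among the edges of a graph
   covered by k bicliques, each edge at most t times, those covered exactly t
   times are partitioned by the intersections of t of the bicliques, once each
   of the t bicliques is oriented: there are at most (2k)^t of these. By
   hypothesis this subgraph has a colouring with polynomially many colours, and
   inside a colour class every edge is covered at most t - 1 times. *)

Require Import Defs.
From mathcomp Require Import all_boot all_order all_algebra.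
From mathcomp Require Import reals.

Set Implicit Arguments.
Unset Strict Implicit.
Unset Printing Implicit Defensive.

Import Order.TTheory GRing.Theory Num.Theory.
Local Open Scope ring_scope.

Lemma leq_wexp2r (e m n : nat) : (m <= n)%N -> (m ^ e <= n ^ e)%N.
Proof. by case: e => // e; rewrite leq_exp2r. Qed.

(** Bounding every coefficient by its absolute value replaces a polynomial by a monotone bound in
    natural numbers, so the rest of the argument avoids the reals. The base is [(g x).+1] because
    powers of a positive base grow with the exponent, even when [g x] is 0. *)
Lemma poly_dominatedP (R : realType) (T : Type) (f g : T -> nat) :
  (exists P : {poly R}, forall x, (f x)%:R <= P.[(g x)%:R]) <->
  (exists a d, forall x, (f x <= a * (g x).+1 ^ d)%N).
Proof.
split=> [[P fP]|[a [d fP]]]; last first.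
  exists (a%:R *: ('X + 1) ^+ d) => x.
  by rewrite !hornerE natr1 -natrX -natrM ler_nat.
pose a := \sum_(i < size P) `|P`_i|.
exists (Num.bound a), (size P) => x.
rewrite -(ler_nat R) (le_trans (fP x)) // horner_coef natrM natrX.
have a_ge0 : 0 <= a by apply: sumr_ge0.
apply: (@le_trans _ _ (a * (g x).+1%:R ^+ size P)); last first.
  by rewrite ler_wpM2r ?exprn_ge0 // ltW // archi_boundP.
rewrite mulr_suml ler_sum // => i _.
apply: (le_trans (ler_norm _)); rewrite normrM ler_wpM2l //.
rewrite ger0_norm ?exprn_ge0 // -!natrX ler_nat.
apply: (@leq_trans ((g x).+1 ^ i)%N); first exact: leq_wexp2r.
by rewrite leq_pexp2l // ltnW.
Qed.

Lemma leq_chiP (G : sgraph) (k : nat) :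
  reflect (exists2 f : G -> nat, (forall x, f x < k)%N &
             forall x y, adj x y -> f x != f y)
          (chi G <= k)%N.
Proof.
rewrite /chi; case: ex_minnP => m colm minm.
apply: (iffP idP) => [mk|[h hk hP]].
  have /existsP[f /'forall_forallP fP] := colm.
  exists (fun x => f x : nat) => [x|x y xy]; first exact: leq_trans (ltn_ord _) mk.
  by have := implyP (fP x y) xy.
apply: minm; apply/existsP; exists [ffun x => Ordinal (hk x)].
by apply/'forall_forallP => x y; apply/implyP => /hP; rewrite !ffunE.
Qed.

Lemma bp_monotone (G : sgraph) (s t : nat) :
  (0 < s)%N -> (s <= t)%N -> (bp G t <= bp G s)%N.
Proof.
move=> s_gt0 st; have [[C covC <-] _] := bp_spec G s_gt0.
apply: (bp_spec G (leq_trans s_gt0 st)).2.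
have /andP[bicC /forall_inP cntC] := covC.
apply/andP; split=> //; apply/forall_inP => e /cntC /andP[-> /=].
by move/leq_trans; apply.
Qed.

Lemma cross_edgesC (G : sgraph) (A B : {set G}) :
  cross_edges A B = cross_edges B A.
Proof.
by apply/setP => e; apply/imsetP/imsetP => -[[x y]];
  rewrite inE /= => /andP[xA yB] ->; exists (y, x);
  rewrite ?inE /= ?xA ?yB // setUC.
Qed.

Lemma set2_inj (T : finType) (x y z w : T) :
  [set x; y] = [set z; w] -> (z = x /\ w = y) \/ (z = y /\ w = x).
Proof.
move=> /setP E; move: (E x) (E y) (E z) (E w); rewrite !inE !eqxx ?orbT /=.
move=> /esym xE /esym yE /orP[] /eqP zE /orP[] /eqP wE; subst; auto.
  by left; split=> //; move: yE; rewrite orbb => /eqP.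
by right; split=> //; move: xE; rewrite orbb => /eqP.
Qed.

Lemma leq_bin_exp (n m : nat) : ('C(n, m) <= n ^ m)%N.
Proof.
elim: m n => [|m IHm] [|n] //.
rewrite -(leq_pmul2l (ltn0Sn m)) -mul_bin_diag expnS mulnCA leq_pmul2l //.
apply: leq_trans (IHm n) _.
apply: leq_trans (leq_pmull _ (ltn0Sn m)).
exact: leq_wexp2r.
Qed.

(* A family of bicliques is encoded by its sides [S i true] and [S i false],
   without an ambient graph: restricting it to a colour class then amounts to
   intersecting the sides with that class, on the same vertex type. *)
Section Family.
Variables (V I : finType) (S : I -> bool -> {set V}).

(* An element [(i, b)] of [signs x y] is a biclique covering the edge xy,
   together with the side on which x lies. *)
Definition signs (x y : V) : {set I * bool} :=
  [set p | (x \in S p.1 p.2) && (y \in S p.1 (~~ p.2))].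

Definition flip (p : I * bool) : I * bool := (p.1, ~~ p.2).

Lemma flipK : involutive flip.
Proof. by case=> i b; rewrite /flip /= negbK. Qed.

Lemma signsC x y : signs y x = flip @: signs x y.
Proof.
apply/setP => p; rewrite -[p in RHS]flipK mem_imset; last exact: inv_inj flipK.
by rewrite !inE /= negbK andbC.
Qed.

Lemma card_signsC x y : #|signs y x| = #|signs x y|.
Proof. by rewrite signsC card_imset //; apply: inv_inj flipK. Qed.

Hypothesis disS : forall i, [disjoint S i true & S i false].

Lemma side_inj x i b c : x \in S i b -> x \in S i c -> b = c.
Proof.
case: b c => [] [] // xb xc.
  by rewrite (disjointFr (disS i) xb) in xc.
by rewrite (disjointFr (disS i) xc) in xb.
Qed.

Lemma signs_irrefl x : signs x x = set0.
Proof.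
apply/setP => -[i b]; rewrite !inE /=; apply/andP => -[xb xc].
by have := side_inj xb xc; case: b {xb xc}.
Qed.

Fact exact_sym s : symmetric (fun x y => #|signs x y| == s.+1).
Proof. by move=> x y; rewrite card_signsC. Qed.

Fact exact_irrefl s : irreflexive (fun x y => #|signs x y| == s.+1).
Proof. by move=> x; rewrite signs_irrefl cards0. Qed.

(** The multiplicity is [s.+1] because multiplicity 0 would put a loop at every vertex: [signs x x]
    is empty. *)
Definition exact_graph (s : nat) : sgraph :=
  SGraph (@exact_sym s) (@exact_irrefl s).

(** When [U] is read as a set of oriented bicliques, [common_side U] and [common_side (flip @: U)]
    are the two sides of their intersection. *)
Definition common_side (U : {set I * bool}) : {set V} :=
  [set z | [forall p in U, z \in S p.1 p.2]].

Lemma mem_common_sides (U : {set I * bool}) z w :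
  (z \in common_side U) && (w \in common_side (flip @: U)) =
  (U \subset signs z w).
Proof.
rewrite !inE; apply/andP/subsetP => [[/forall_inP zU /forall_inP wU] p pU|zwU].
  by rewrite inE zU //= (wU (flip p)) // imset_f.
split; apply/forall_inP => p; first by move/zwU; rewrite inE => /andP[].
by case/imsetP => q /zwU; rewrite inE => /andP[_ ?] ->.
Qed.

Variable s : nat.
Hypothesis signs_le : forall x y, (#|signs x y| <= s.+1)%N.

Let biclique (U : {set I * bool}) : {set {set exact_graph s}} :=
  cross_edges (common_side U : {set exact_graph s}) (common_side (flip @: U)).

Let biclique_flip (U : {set I * bool}) : biclique (flip @: U) = biclique U.
Proof.
by rewrite /biclique cross_edgesC -imset_comp (eq_imset _ flipK) imset_id.
Qed.

Let signs_full (U : {set I * bool}) x y :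
  #|U| = s.+1 -> U \subset signs x y -> U = signs x y.
Proof.
by move=> cU sU; apply/eqP; rewrite eqEcard sU cU signs_le.
Qed.

(** If [U] has the maximal size [s.+1], then [U \subset signs z w] forces equality. Hence an edge xy
    lies in [biclique U] only for [U] equal to [signs x y] or [signs y x], and these two opposite
    orientations give the same edge set. The bound counts the subsets of [I * bool] of size
    [s.+1]. *)
Lemma bp_exact_graph : (bp (exact_graph s) 1 <= (#|I| * 2) ^ s.+1)%N.
Proof.
pose D := [set U : {set I * bool} | (#|U| == s.+1) &&
   ((common_side U != set0) && (common_side (flip @: U) != set0))].
have cardC : (#|biclique @: D| <= (#|I| * 2) ^ s.+1)%N.
  apply: leq_trans (leq_imset_card _ _) _.
  have -> : (#|I| * 2 = #|{: I * bool}|)%N by rewrite card_prod card_bool.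
  apply: leq_trans (leq_bin_exp _ _); rewrite -card_draws.
  by apply/subset_leq_card/subsetP => U; rewrite !inE => /andP[].
apply: leq_trans cardC; apply: (bp_spec _ (ltn0Sn 0)).2.
have mem_biclique (U : {set I * bool}) (x y : V) :
    #|U| = s.+1 -> [set x; y] \in biclique U ->
    U = signs x y \/ U = signs y x.
  move=> cU /imsetP[[z w]]; rewrite in_setX mem_common_sides /= => sU.
  by rewrite (signs_full cU sU) => /set2_inj [] [-> ->]; auto.
apply/andP; split.
  apply/forall_inP => _ /imsetP[U + ->].
  rewrite inE => /andP[/eqP cU /andP[A0 B0]].
  apply/andP; split.
    apply/subsetP => _ /imsetP[[z w] + ->].
    rewrite in_setX mem_common_sides => sU.
    by apply/imsetP; exists (z, w) => //; rewrite inE /= -(signs_full cU sU) cU.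
  apply/existsP; exists (common_side U).
  apply/existsP; exists (common_side (flip @: U)); rewrite A0 B0 eqxx andbT /=.
  rewrite disjoint_subset; apply/subsetP => z zA; rewrite inE; apply/negP => zB.
  have : U \subset signs z z by rewrite -mem_common_sides zA.
  by rewrite signs_irrefl subset0 -cards_eq0 cU.
apply/forall_inP => _ /imsetP[[x y] + ->]; rewrite inE /= => /eqP cxy.
suff -> : [set H in biclique @: D | [set x; y] \in H] = [set biclique (signs x y)].
  by rewrite cards1.
have /andP[xA yB] : (x \in common_side (signs x y)) &&
    (y \in common_side (flip @: signs x y)) by rewrite mem_common_sides.
apply/setP => H; rewrite !inE; apply/andP/eqP => [[/imsetP[U + ->]]|->].
  rewrite inE => /andP[/eqP cU _] /(mem_biclique _ _ _ cU) [->|->] //.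
  by rewrite signsC biclique_flip.
split; last by apply/imsetP; exists (x, y) => //; rewrite in_setX xA yB.
apply: imset_f; rewrite inE cxy eqxx /=.
by apply/andP; split; apply/set0Pn; [exists x | exists y].
Qed.

End Family.

(** The constants [b] and [e] are chosen before the family, so the induction hypothesis applies to
    all colour classes with one common bound. Restriction keeps the index type [I], even if some
    sides become empty. *)
Lemma family_coloring (a d : nat) :
    (forall G, chi G <= a * (bp G 1).+1 ^ d)%N ->
  forall t, exists b e, forall (V I : finType) (S : I -> bool -> {set V}),
    (forall i, [disjoint S i true & S i false]) ->
    (forall x y, #|signs S x y| <= t)%N ->
  exists2 f : V -> nat, (forall x, f x < b * #|I|.+1 ^ e)%N &
    forall x y, (0 < #|signs S x y|)%N -> f x != f y.
Proof.
move=> chi_le; elim=> [|t [b [e IH]]].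
  exists 1%N, 0%N => V I S _ signs0; exists (fun=> 0%N) => // x y.
  by rewrite ltnNge signs0.
exists (a * (2 ^ t.+1) ^ d * b)%N, (t.+1 * d + e)%N => V I S disS signs_le.
set k := #|I|; set B := (b * k.+1 ^ e)%N.
have /leq_chiP[f f_lt fP] := leqnn (chi (exact_graph disS t)).
set m := chi _ in f_lt.
have m_le : (m <= a * (2 ^ t.+1) ^ d * k.+1 ^ (t.+1 * d))%N.
  apply: leq_trans (chi_le _) _; rewrite -mulnA leq_mul2l expnM -expnMn.
  apply/orP; right; apply: leq_wexp2r.
  (* The successor in [(bp _ 1).+1] is absorbed by the strict inequality between the powers of
     [2 * k] and [2 * k.+1]. *)
  apply: leq_ltn_trans (bp_exact_graph disS signs_le) _.
  by rewrite mulnC -expnMn ltn_exp2r // ltn_pmul2l.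
have step (c : 'I_m) : exists g : V -> nat, (forall x, g x < B)%N /\
    forall x y, f x = c -> f y = c -> (0 < #|signs S x y|)%N -> g x != g y.
  pose S' i v := S i v :&: [set x | f x == c].
  have signsE x y : f x = c -> f y = c -> signs S' x y = signs S x y.
    by move=> fx fy; apply/setP => p; rewrite !inE fx fy eqxx !andbT.
  have signs_sub x y : signs S' x y \subset signs S x y.
    by apply/subsetP => p; rewrite !inE => /andP[/andP[-> _] /andP[-> _]].
  have [|x y|g gB gP] := IH V I S'.
  - by move=> i; apply: disjointWl (subsetIl _ _) (disjointWr (subsetIl _ _) _).
  - rewrite -ltnS ltn_neqAle.
    rewrite (leq_trans (subset_leq_card (signs_sub x y)) (signs_le x y)) andbT.
    (* A pair with [t.+1] restricted signs would have both ends in class [c] and be an edge of the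
       exact graph, against the properness of [f]. *)
    apply/negP => /eqP cxy.
    have /card_gt0P[p] : (0 < #|signs S' x y|)%N by rewrite cxy.
    rewrite !inE => /andP[/andP[_ /eqP fx] /andP[_ /eqP fy]].
    have := fP x y; rewrite /= -signsE // cxy eqxx fx fy eqxx.
    by move/(_ isT).
  exists g; split=> // x y fx fy; rewrite -signsE //; exact: gP.
have [g gP] := fin_all_exists step.
pose h x := g (Ordinal (f_lt x)) x.
have hB x : (h x < B)%N by apply: (gP _).1.
(* This encodes the pair of colours [(f x, h x)] in base [B]; division by [B] recovers [f x]. *)
exists (fun x => f x * B + h x)%N => [x|x y xy].
  apply: (@leq_trans (m * B)%N); last by rewrite expnD mulnACA leq_mul2r m_le orbT.
  apply: (@leq_trans (f x * B + B)%N); first by rewrite ltn_add2l.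
  by rewrite addnC -mulSn leq_mul2r f_lt orbT.
have B_gt0 : (0 < B)%N by apply: leq_ltn_trans (hB x).
apply/eqP => E.
have fE : f x = f y.
  by move/(congr1 (divn^~ B)): E; rewrite !divnMDl // !divn_small // !addn0.
have hE : h x = h y by move: E; rewrite fE => /addnI.
move/eqP: hE; apply/negP.
rewrite /h (_ : Ordinal (f_lt y) = Ordinal (f_lt x)); last exact: val_inj.
by apply: (gP _).2.
Qed.

(** The index type is a minimum covering itself, with two sides chosen for each biclique. As the
    sides are disjoint, a biclique contributes at most one sign to a pair, so signs count the
    bicliques that cover it. *)
Lemma bp_family (G : sgraph) (t : nat) : (0 < t)%N ->
  exists (I : finType) (S : I -> bool -> {set G}),
  [/\ #|I| = bp G t, forall i, [disjoint S i true & S i false],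
      forall x y, (#|signs S x y| <= t)%N &
      forall x y, adj x y -> (0 < #|signs S x y|)%N].
Proof.
move=> t_gt0; have [[C /andP[/forall_inP bicC /forall_inP cntC] cardC] _] :=
  bp_spec G t_gt0.
have sidesP (H : {H | H \in C}) : exists T : bool -> {set G},
    [/\ [disjoint T true & T false], val H \subset edges G &
        val H = cross_edges (T true) (T false)].
  have /andP[sH /existsP[A /existsP[B /and4P[_ _ dAB /eqP HE]]]] := bicC _ (valP H).
  by exists (fun b => if b then A else B).
have [S SP] := fin_all_exists sidesP.
have disS i : [disjoint S i true & S i false] by case: (SP i).
have sub_edges (i : {H | H \in C}) : val i \subset edges G by case: (SP i).
have sideE (i : {H | H \in C}) b : val i = cross_edges (S i b) (S i (~~ b)).
  by case: b; [|rewrite cross_edgesC]; case: (SP i).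
have mem_signs x y p : p \in signs S x y -> [set x; y] \in val p.1.
  rewrite inE (sideE p.1 p.2) => xy.
  by apply/imsetP; exists (x, y); rewrite ?in_setX.
exists {H | H \in C}, S; split=> //; first by rewrite card_sig.
(* The covering bounds only the multiplicity of edges, but a pair with a sign is an edge, since each
   biclique consists of edges of [G]. *)
- move=> x y; have [->|/set0Pn[p pxy]] := eqVneq (signs S x y) set0.
    by rewrite cards0.
  have /cntC/andP[_] := subsetP (sub_edges p.1) _ (mem_signs _ _ _ pxy).
  apply: leq_trans.
  have inj : {in signs S x y &, injective (fun q => val q.1)}.
    move=> [i b] [j c]; rewrite !inE /= => /andP[xb _] /andP[xc _] /val_inj ij.
    by rewrite -ij in xc *; rewrite (side_inj disS xb xc).
  rewrite -(card_in_imset inj); apply/subset_leq_card/subsetP => _ /imsetP[q qxy ->].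
  by rewrite inE (valP q.1) (mem_signs _ _ _ qxy).
- move=> x y xy; have : [set x; y] \in edges G.
    by apply/imsetP; exists (x, y); rewrite ?inE.
  move=> /cntC/andP[/card_gt0P[H]]; rewrite inE => /andP[HC eH] _.
  move: eH; rewrite -[H]/(val (exist (fun H => H \in C) H HC)) (sideE _ true).
  case/imsetP => -[z w]; rewrite in_setX /= => zw /set2_inj E.
  suff : exists p, p \in signs S x y by move=> ?; apply/card_gt0P.
  (* Edges are unordered, so x may lie on either side; this decides the boolean of the sign. *)
  set i := exist _ _ _ in zw; case: E => -[? ?]; subst z w.
    by exists (i, true); rewrite inE.
  by exists (i, false); rewrite inE /= andbC.
Qed.

Theorem theorem23 (R : realType) (t : nat) (t_gt0 : (0 < t)%N) :
  (exists Pt : {poly R},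
     forall G : sgraph, (chi G)%:R <= Pt.[(bp G t)%:R])
  <->
  (exists P1 : {poly R},
     forall G : sgraph, (chi G)%:R <= P1.[(bp G 1)%:R]).
Proof.
split=> /poly_dominatedP[a [d chi_le]]; apply/poly_dominatedP.
  (* A 1-covering is also a t-covering, and the bound, unlike an arbitrary polynomial, is
     nondecreasing. *)
  exists a, d => G; apply: leq_trans (chi_le G) _; rewrite leq_mul2l.
  by apply/orP; right; apply: leq_wexp2r; rewrite ltnS bp_monotone.
have [b [e fam]] := family_coloring chi_le t.
exists b, e => G; have [I [S [<- disS signs_le signs_gt0]]] := bp_family G t_gt0.
have [f f_lt fP] := fam _ _ _ disS signs_le.
by apply/leq_chiP; exists f => // x y /signs_gt0; apply: fP.
Qed.
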